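(* Let $\mathfrak{g}$ be a non-Kähler (i.e. not admitting Kähler structures) $6$-dimensional strongly unimodular almost nilpotent real Lie algebra with nilradical $\mathfrak{n}$ satisfying $\dim\mathfrak{n}^1=1$, where $\mathfrak{n}^1=[\mathfrak{n},\mathfrak{n}]$. Then $\mathfrak{g}$ does not admit generalized Kähler structures $(J_+,J_-,g)$ such that $(J_+,g)$ satisfies $J_+(\mathfrak{n}^1)\subset\mathfrak{n}$ and $\mathfrak{k}_3$ is an abelian ideal.
   Context: The nilradical $\mathfrak{n}$ of a solvable Lie algebra $\mathfrak{g}$ is its maximal nilpotent ideal; $\mathfrak{g}$ is almost nilpotent if it is solvable and $\mathfrak{n}$ has codimension one. With $\mathfrak{n}^0=\mathfrak{n}$, $\mathfrak{n}^{l}=[\mathfrak{n},\mathfrak{n}^{l-1}]$, a solvable $\mathfrak{g}$ is strongly unimodular if $\operatorname{tr}(\mathrm{ad}_X|_{\mathfrak{n}^l/\mathfrak{n}^{l+1}})=0$ for all $X\in\mathfrak{g}$, $l\in\mathbb{N}$. A generalized Kähler structure on $\mathfrak{g}$ is a triple $(J_+,J_-,g)$ where $J_\pm$ are integrable complex structures on $\mathfrak{g}$ and $g$ is a positive definite inner product orthogonal with respect to both, such that $dd^c_\pm\omega_\pm=0$ and $d^c_+\omega_++d^c_-\omega_-=0$, where $\omega_\pm=g(J_\pm\cdot,\cdot)$, $d$ is the Chevalley–Eilenberg differential and $d^c_\pm=i(\overline\partial_\pm-\partial_\pm)$ with respect to $J_\pm$. A Kähler structure is a Hermitian structure $(J,g)$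 with $d\omega=0$. When $J_+\mathfrak{n}^1\subset\mathfrak{n}$, $\mathfrak{k}_3$ is determined by $(J_+,g)$: $\mathfrak{k}_2=(\mathfrak{n}^1)^{\perp_g}\cap\mathfrak{n}$, $\mathfrak{k}_3=\mathfrak{k}_2\cap J_+\mathfrak{k}_2$ (two-dimensional here). *)

(* Defs.v *)
From HB Require Import structures.
From mathcomp Require Import all_boot all_order all_algebra.
From mathcomp Require Import sesquilinear reals complex.

Set Implicit Arguments.
Unset Strict Implicit.
Unset Printing Implicit Defensive.

Import GRing.Theory Num.Theory.
Local Open Scope ring_scope.

HB.mixin Record isLieAlgebra (K : fieldType) g of Vector K g := {
  lbr : g -> g -> g;
  lbrPl : forall (a : K) (x y z : g), lbr (a *: x + y) z = a *: lbr x z + lbr y z;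
  lbrPr : forall (a : K) (x y z : g), lbr x (a *: y + z) = a *: lbr x y + lbr x z;
  lbrxx : forall x : g, lbr x x = 0;
  lbr_jacobi : forall x y z : g,
    lbr x (lbr y z) + lbr y (lbr z x) + lbr z (lbr x y) = 0
}.

#[short(type="lieAlgType")]
HB.structure Definition LieAlgebra (K : fieldType) :=
  { g of isLieAlgebra K g & Vector K g }.

Section LieAlgebras.
Variables (K : fieldType) (g : lieAlgType K).
Implicit Types (U V W I : {vspace g}) (x y : g).

Definition ad x : g -> g := lbr x.

Fact ad_linear x : linear (ad x).
Proof. by move=> a y z; rewrite /ad lbrPr. Qed.

HB.instance Definition _ x :=
  GRing.isSemilinear.Build K g g _ (ad x) (GRing.semilinear_linear (ad_linear x)).

Definition lbrv U V : {vspace g} :=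
  <<[seq lbr u v | u <- vbasis U, v <- vbasis V]>>%VS.

Lemma lbrv_subP U V W :
  reflect {in U & V, forall u v, lbr u v \in W} (lbrv U V <= W)%VS.
Proof.
apply: (iffP span_subvP) => [brW u v uU vV | brW _ /allpairsP[[u v] /= [uU vV ->]]].
  have lbrl (z : g) : linear (lbr^~ z) by move=> a y t; rewrite lbrPl.
  pose lz (z : g) := GRing.isSemilinear.Build K g g _ _ (GRing.semilinear_linear (lbrl z)).
  pose f z : {linear g -> g} := HB.pack (lbr^~ z) (lz z).
  rewrite (coord_vbasis uU) -[lbr _ _]/(f v _) linear_sum memv_suml // => i _.
  rewrite linearZ memvZ //= (coord_vbasis vV) -[lbr _ _]/(ad _ _) linear_sum.
  rewrite memv_suml // => j _; rewrite linearZ memvZ //= /ad brW //.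
  by apply/allpairsP; exists ((vbasis U)`_i, (vbasis V)`_j); rewrite !mem_nth ?size_tuple.
by apply: brW; rewrite vbasis_mem.
Qed.

Definition is_ideal I := (lbrv fullv I <= I)%VS.

Definition is_abelian U := lbrv U U == 0%VS.

Fixpoint lower_central U (l : nat) : {vspace g} :=
  if l is l'.+1 then lbrv U (lower_central U l') else U.

Fixpoint derived_series U (l : nat) : {vspace g} :=
  if l is l'.+1 then lbrv (derived_series U l') (derived_series U l') else U.

Definition is_nilpotent U := exists l, lower_central U l = 0%VS.

Definition is_solvable U := exists l, derived_series U l = 0%VS.

Definition is_nilradical n :=
  [/\ is_ideal n, is_nilpotent n &
      forall I, is_ideal I -> is_nilpotent I -> (n <= I)%VS -> I = n].

Definition almost_nilpotent n :=
  [/\ is_solvable fullv, is_nilradical n & \dim {: g} = (\dim n).+1].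

(* The quotient U/W (for W <= U) is modelled by the complement U :\: W of W in
   U, with quotient map addv_pi1 U W, the projection onto U :\: W along W. If f
   preserves U and W then quot_end f U W is the endomorphism of U/W induced by
   f, whose trace is read in the basis vbasis of this model. *)
Definition quot_end (f : g -> g) U W (u : subvs_of (U :\: W)) :
  subvs_of (U :\: W) := vsproj (U :\: W) (addv_pi1 U W (f (vsval u))).

Definition quot_trace (f : g -> g) U W : K :=
  \sum_(i < \dim {: subvs_of (U :\: W)})
    coord (vbasis {: subvs_of (U :\: W)}) i
      (@quot_end f U W (vbasis {: subvs_of (U :\: W)})`_i).

Definition strongly_unimodular n :=
  forall x (l : nat),
    quot_trace (ad x) (lower_central n l) (lower_central n l.+1) = 0.

End LieAlgebras.

Section Forms.
Variables (R : realType) (g : lieAlgType R).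
Implicit Types (J : 'End(g)) (k p : nat).

Local Notation C := R[i].

(* Complex-valued k-forms on g. Multilinearity and alternation are not bundled:
   the operators below are only applied to forms obtained from the fundamental
   form of a Hermitian structure. *)
Definition cform k := k.-tuple g -> C.

(* (d a)(x_0, ..., x_{k+1}) = \sum_{i < j'} (-1)^(i + j')
     a([x_i, x_j'], x_0, ..., ^x_i, ..., ^x_j', ..., x_{k+1});
   the index j' > i is written lift i j, with i <= j, so that j' = j + 1. *)
Definition ce_diff k (a : cform k.+1) : cform k.+2 := fun x =>
  \sum_(i < k.+2) \sum_(j < k.+1 | (i <= j)%N)
    (-1) ^+ (i + j.+1) *
      a [tuple of lbr (tnth x i) (tnth x (lift i j)) ::
                  [tuple tnth x (lift i (lift j m)) | m < k]].

(* The (p, k - p)-component of a: with a extended C-multilinearly to the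
   complexification, and x^{1,0} = (x - i J x) / 2, x^{0,1} = (x + i J x) / 2,
     a^{p,k-p}(x_0, ...) = \sum_{#|S| = p} a(y_0, ...),
   where y_j = x_j^{1,0} for j in S and y_j = x_j^{0,1} otherwise. The inner
   sum is the expansion of a(y_0, ...), T being the set of the indices j at
   which the summand -+ i J x_j is chosen. *)
Definition type_comp J k p (a : cform k) : cform k := fun x =>
  \sum_(S : {set 'I_k} | #|S| == p) 2%:R ^- k *
    \sum_(T : {set 'I_k}) (\prod_(j in T) if j \in S then - 'i%C else 'i%C) *
      a [tuple (if j \in T then J (tnth x j) else tnth x j) | j < k].

Definition del J k (a : cform k.+1) : cform k.+2 := fun x =>
  \sum_(p < k.+2) type_comp J p.+1 (ce_diff (type_comp J p a)) x.

Definition delbar J k (a : cform k.+1) : cform k.+2 := fun x =>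
  \sum_(p < k.+2) type_comp J p (ce_diff (type_comp J p a)) x.

Definition dc J k (a : cform k.+1) : cform k.+2 := fun x =>
  'i%C * (delbar J a x - del J a x).

Definition is_complex_structure J :=
  (forall x, J (J x) = - x) /\
  (forall x y, lbr (J x) (J y) - J (lbr (J x) y) - J (lbr x (J y)) - lbr x y = 0).

Definition is_hermitian J (m : {dot g for idfun}) :=
  is_complex_structure J /\ (forall x y, m (J x) (J y) = m x y).

Definition fund_form J (m : {dot g for idfun}) : cform 2 := fun x =>
  (m (J (tnth x ord0)) (tnth x ord_max))%:C%C.

Definition is_kahler J m :=
  is_hermitian J m /\ (forall x, ce_diff (fund_form J m) x = 0).

Definition is_generalized_kahler Jp Jm m :=
  [/\ is_hermitian Jp m, is_hermitian Jm m,
      forall x, ce_diff (dc Jp (fund_form Jp m)) x = 0,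
      forall x, ce_diff (dc Jm (fund_form Jm m)) x = 0 &
      forall x, dc Jp (fund_form Jp m) x + dc Jm (fund_form Jm m) x = 0].

Definition k2 (n : {vspace g}) (m : {dot g for idfun}) : {vspace g} :=
  (orthov m (lower_central n 1) :&: n)%VS.

Definition k3 (n : {vspace g}) J (m : {dot g for idfun}) : {vspace g} :=
  (k2 n m :&: J @: k2 n m)%VS.

End Forms.

(* Main.v *)
Require Import Defs.
From HB Require Import structures.
From mathcomp Require Import all_boot all_order all_algebra.
From mathcomp Require Import sesquilinear reals complex.
From mathcomp Require Import boolp ring lra.

Set Implicit Arguments.
Unset Strict Implicit.
Unset Printing Implicit Defensive.

Import Order.TTheory GRing.Theory Num.Theory.
Local Open Scope ring_scope.

(* Let X and Z be unit vectors spanning the orthogonal of n and n^1, and put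
   W = J_+ X, U = J_+ Z. Strong unimodularity makes Z central, and the ideal
   k_3 = <X, W, Z, U>^perp is central in n, so the only bracket of n is
   [W, U] = c Z with c != 0. Integrability of J_+ on (X, Z) gives
   [X, U] = - c U, and the Jacobi identity on (X, W, U) then gives
   g([X, W], W) = c.
   The condition d^c_+ omega_+ + d^c_- omega_- = 0 says that J_- is parallel for
   the metric connection whose torsion is opposite to that of the Bismut
   connection of J_+. Its derivative along the central vector Z is, up to a
   scalar, the rotation of the plane <W, U>, so J_- preserves this plane:
   J_- W = e U, and J_- X lies in n orthogonally to W and U, hence is central
   in n. Finally, the W-component of the integrability of J_- on (X, W) reads
   - c e^2 - c = 0. *)

(** * Sums over subsets of two or three indices *)

Section BigSets.
Variables (V : nmodType).

(** Subsets are coded by their indicator booleans, so that sums over them expand by computation. *)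
Definition bset2 (b : bool * bool) : {set 'I_2} :=
  [set i : 'I_2 | nth false [:: b.1; b.2] i].

Definition bset3 (b : bool * bool * bool) : {set 'I_3} :=
  [set i : 'I_3 | nth false [:: b.1.1; b.1.2; b.2] i].

Lemma big_bset2 (F : {set 'I_2} -> V) :
  \sum_(S : {set 'I_2}) F S = \sum_(b : bool * bool) F (bset2 b).
Proof.
rewrite (reindex bset2) //=.
exists (fun S : {set 'I_2} => (ord0 \in S, ord_max \in S)) => [[a b] _|S _].
  by rewrite !inE.
by apply/setP => -[[|[|//]] lti]; rewrite inE /=; congr (_ \in S); apply: val_inj.
Qed.

Lemma big_bset3 (F : {set 'I_3} -> V) :
  \sum_(S : {set 'I_3}) F S = \sum_(b : bool * bool * bool) F (bset3 b).
Proof.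
rewrite (reindex bset3) //=.
exists (fun S : {set 'I_3} => (ord0 \in S, inord 1 \in S, ord_max \in S)).
  by move=> [[a b] c] _; rewrite !inE inordK.
move=> S _; apply/setP => -[[|[|[|//]]] lti]; rewrite inE /=;
  by congr (_ \in S); apply: val_inj; rewrite /= ?inordK.
Qed.

Lemma big_bool2 (F : bool * bool -> V) :
  \sum_b F b = F (true, true) + F (true, false) + (F (false, true) + F (false, false)).
Proof.
rewrite (eq_bigr (fun p => F (p.1, p.2))); last by case.
rewrite -(pair_bigA _ (fun a b => F (a, b))) /=.
by rewrite !big_bool.
Qed.

Lemma big_bool3 (F : bool * bool * bool -> V) :
  \sum_b F b = \sum_(b : bool * bool) F (b, true) + \sum_(b : bool * bool) F (b, false).
Proof.
rewrite (eq_bigr (fun p => F (p.1, p.2))); last by case.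
rewrite -(pair_bigA _ (fun a b => F (a, b))) /=.
by rewrite -big_split; apply: eq_bigr => b _; rewrite big_bool.
Qed.

End BigSets.

Lemma mktuple2 (T : Type) (f : 'I_2 -> T) :
  [tuple f j | j < 2] = [tuple f ord0; f ord_max].
Proof.
apply: eq_from_tnth => -[[|[|//]] lti]; rewrite tnth_mktuple (tnth_nth (f ord0)) /=;
  by congr f; apply: val_inj.
Qed.

Lemma mktuple3 (T : Type) (f : 'I_3 -> T) :
  [tuple f j | j < 3] = [tuple f ord0; f (inord 1); f ord_max].
Proof.
apply: eq_from_tnth => -[[|[|[|//]]] lti]; rewrite tnth_mktuple (tnth_nth (f ord0)) /=;
  by congr f; apply: val_inj; rewrite /= ?inordK.
Qed.

(** * Type components of 2-forms and 3-forms *)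

Section TypeComp.
Variables (R : realType) (g : lieAlgType R) (J : 'End(g)).
Local Notation C := R[i].

(** A true entry of [S] selects the (1,0)-part of that argument, and [f] is the resulting
    coefficient of [J]; the four terms are the possible sets [T]. *)
Lemma type_comp2E p (a : cform g 2) x y :
  let f (b : bool) : C := if b then - 'i%C else 'i%C in
  type_comp J p a [tuple x; y] =
  \sum_(S : bool * bool | (S.1 + S.2 == p)%N) 4%:R^-1 *
  (a [tuple x; y]
   + f S.1 * a [tuple J x; y]
   + f S.2 * a [tuple x; J y]
   + f S.1 * f S.2 * a [tuple J x; J y]).
Proof.
move=> f; rewrite /type_comp big_mkcond big_bset2 [RHS]big_mkcond.
apply: eq_bigr => -[s0 s1] _.
have -> : #|bset2 (s0, s1)| = (s0 + s1)%N.
  rewrite -sum1_card big_mkcond !big_ord_recl big_ord0 /= !inE /=.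
  by case: s0; case: s1.
case: ifP => // _; rewrite -natrX; congr (_ * _).
rewrite big_bset2 big_bool2 /= !mktuple2.
rewrite !(big_mkcond (fun j => j \in _)) /=.
rewrite !big_ord_recl !big_ord0 /= !inE /= -/(f s0) -/(f s1).
rewrite !(tnth_nth 0) /=.
ring.
Qed.

Lemma type_comp3E p (a : cform g 3) x y z :
  let f (b : bool) : C := if b then - 'i%C else 'i%C in
  type_comp J p a [tuple x; y; z] =
  \sum_(S : bool * bool * bool | (S.1.1 + S.1.2 + S.2 == p)%N) 8%:R^-1 *
  (a [tuple x; y; z]
   + f S.1.1 * a [tuple J x; y; z]
   + f S.1.2 * a [tuple x; J y; z]
   + f S.2 * a [tuple x; y; J z]
   + f S.1.1 * f S.1.2 * a [tuple J x; J y; z]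
   + f S.1.1 * f S.2 * a [tuple J x; y; J z]
   + f S.1.2 * f S.2 * a [tuple x; J y; J z]
   + f S.1.1 * f S.1.2 * f S.2 * a [tuple J x; J y; J z]).
Proof.
move=> f; rewrite /type_comp big_mkcond big_bset3 [RHS]big_mkcond.
apply: eq_bigr => -[[s0 s1] s2] _.
have -> : #|bset3 (s0, s1, s2)| = (s0 + s1 + s2)%N.
  rewrite -sum1_card big_mkcond !big_ord_recl big_ord0 /= !inE /=.
  by case: s0; case: s1; case: s2.
case: ifP => // _; rewrite -natrX; congr (_ * _).
rewrite big_bset3 big_bool3 !big_bool2 /= !mktuple3.
rewrite !(big_mkcond (fun j => j \in _)) /=.
rewrite !big_ord_recl !big_ord0 /= !inE /= ?inordK //= -/(f s0) -/(f s1) -/(f s2).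
rewrite !(tnth_nth 0) /= ?inordK //=.
ring.
Qed.

End TypeComp.

Lemma tuple2E (T : Type) (t : 2.-tuple T) : exists x y, t = [tuple x; y].
Proof.
case/tupleP: t => x t; case/tupleP: t => y t; exists x, y.
by rewrite (tuple0 t); apply: val_inj.
Qed.

(** * Bilinearity and antisymmetry of the bracket *)

Section LieBracket.
Variables (K : fieldType) (g : lieAlgType K).

Fact lbr_bilinear : bilinear_for *:%R *:%R (@lbr K g).
Proof. by split=> [y a u v|x a u v]; rewrite ?lbrPl ?lbrPr. Qed.

HB.instance Definition _ :=
  bilinear_isBilinear.Build K g g g *:%R *:%R (@lbr K g) lbr_bilinear.

Lemma lbrC (x y : g) : lbr x y = - lbr y x.
Proof.
have := lbrxx (x + y).
by rewrite linearDl !linearDr /= !lbrxx add0r addr0 => /eqP; rewrite addr_eq0 => /eqP.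
Qed.

End LieBracket.

(** * Differentials of the fundamental form *)

Section Dc.
Variables (R : realType) (g : lieAlgType R) (J : 'End(g)).
Local Notation C := R[i].
Implicit Types (m : {dot g for idfun}).

Lemma ce_diff2E (a : cform g 2) x y z :
  ce_diff a [tuple x; y; z] =
    a [tuple lbr x z; y] - a [tuple lbr x y; z] - a [tuple lbr y z; x].
Proof.
rewrite /ce_diff !big_ord_recl !big_ord0 /=.
rewrite !(big_mkcond (fun j : 'I_2 => _ <= j)%N) !big_ord_recl !big_ord0 /=.
rewrite !(tnth_nth 0) /=.
have E (f : 'I_1 -> g) u : [tuple of u :: [tuple f j | j < 1]] = [tuple u; f ord0].
  apply: eq_from_tnth => -[[|[|//]] lti]; rewrite !(tnth_nth 0) //=.
  by rewrite enum_ordSl /=.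
rewrite !E !(tnth_nth 0) /=.
rewrite /bump /=; ring.
Qed.

(** Orthogonality of [J] makes the fundamental form [J]-invariant, that is, of type (1,1). *)
Lemma type_comp_fund m p : is_hermitian J m ->
  type_comp J p (fund_form J m) = if p == 1%N then fund_form J m else fun=> 0.
Proof.
move=> [[JJ _] mJ]; apply: funext => t; have [x [y ->]] := tuple2E t.
have i2 : 'i%C ^+ 2 = -1 :> C := sqr_i R.
rewrite type_comp2E big_mkcond big_bool2 /= /fund_form !(tnth_nth 0) /=.
rewrite !mJ !JJ !linearNl !rmorphN /=.
by case: p => [|[|[|p]]] //=; rewrite ?addr0 ?add0r ?tnth_mktuple //=; field: i2.
Qed.

Lemma ce_diff0 k : ce_diff ((fun=> 0) : cform g k.+1) = fun=> 0.
Proof.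
apply: funext => t; rewrite /ce_diff big1 // => i _.
by rewrite big1 // => j _; rewrite mulr0.
Qed.

Lemma type_comp0 k p : type_comp J p ((fun=> 0) : cform g k) = fun=> 0.
Proof.
apply: funext => t; rewrite /type_comp big1 // => S _.
by rewrite big1 ?mulr0 // => T _; rewrite mulr0.
Qed.

(* The value of d omega at (a, b, c), where omega = m (J _) _. *)
Definition dfund m (a b c : g) : R :=
  m (lbr a b) (J c) + m (lbr b c) (J a) + m (lbr c a) (J b).

Lemma ce_diff_fund m x y z : is_hermitian J m ->
  ce_diff (fund_form J m) [tuple x; y; z] = (dfund m x y z)%:C%C.
Proof.
move=> [[JJ _] mJ]; rewrite ce_diff2E /fund_form !(tnth_nth 0) /=.
have skew a b : m (J a) b = - m a (J b) by rewrite -mJ JJ linearNl.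
rewrite -!rmorphB !skew /dfund (lbrC z x) linearNl /=.
by congr (_%:C)%C; ring.
Qed.

(* d omega has no component of type (3, 0) or (0, 3). *)
Lemma dfund_type m x y z : is_hermitian J m ->
  dfund m x y z = dfund m (J x) (J y) z + dfund m (J x) y (J z) + dfund m x (J y) (J z).
Proof.
move=> [[JJ NJ] mJ]; rewrite /dfund.
(* Integrability paired with [J c]; its three cyclic instances add up to the claim. *)
have N a b c : m (lbr (J a) (J b)) (J c) - m (lbr (J a) b) c - m (lbr a (J b)) c
   = m (lbr a b) (J c).
  have /(congr1 (fun v => m v (J c))) := NJ a b.
  rewrite !linearBl /= !mJ linear0l /=.
  by move=> /eqP; rewrite subr_eq0 => /eqP.
have L u v : m u (J (J v)) = - m u v by rewrite JJ linearNr.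
rewrite -(N x y z) -(N y z x) -(N z x y) !L; ring.
Qed.

(** As omega has type (1,1), [del] and [delbar] yield the (2,1)- and (1,2)-components of d omega. *)
Lemma dc_fund_form m x y z : is_hermitian J m ->
  dc J (fund_form J m) [tuple x; y; z] = - (dfund m (J x) (J y) (J z))%:C%C.
Proof.
move=> hJ; have i2 : 'i%C ^+ 2 = -1 :> C := sqr_i R.
rewrite /dc /del /delbar !big_ord_recl !big_ord0 /= !type_comp_fund //=.
rewrite !ce_diff0 !type_comp0 !addr0 !add0r /bump /= addn0.
set a := ce_diff _; rewrite !type_comp3E !(big_mkcond (fun S => _ == _)).
rewrite !big_bool3 !big_bool2 /= {}/a !ce_diff_fund //.
(* The left side of the goal comes out as minus a quarter of the sum of the terms with one [J],
   minus three quarters of the term with three. These two quantities agree, d omega having no (3,0)-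
   or (0,3)-part. *)
have -> : dfund m (J x) (J y) (J z) =
    dfund m (J x) y z + dfund m x (J y) z + dfund m x y (J z).
  rewrite (@dfund_type m (J x)) // !hJ.1.1 /dfund.
  by do !rewrite !(linearNl, linearNr, linearN) /=; ring.
by rewrite !rmorphD /=; field: i2.
Qed.

End Dc.

(** * Lower central series and strong unimodularity *)

Section Ideals.
Variables (K : fieldType) (g : lieAlgType K).
Implicit Types (U V W I n : {vspace g}) (x y z : g).

Lemma mem_lbrv U V u v : u \in U -> v \in V -> lbr u v \in lbrv U V.
Proof. by move: u v; apply/lbrv_subP. Qed.

Lemma mem_ideal I x v : is_ideal I -> v \in I -> lbr x v \in I.
Proof. by move=> /lbrv_subP idI; apply/idI/memvf. Qed.

Lemma lbr_derivation x y z : lbr x (lbr y z) = lbr (lbr x y) z + lbr y (lbr x z).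
Proof.
have /eqP := lbr_jacobi x y z.
rewrite -addrA addr_eq0 => /eqP ->; rewrite (lbrC z x) (lbrC z) linearNr /=.
by rewrite opprD !opprK addrC.
Qed.

(** Since [ad x] is a derivation, the preimage of [I, I] under it contains the brackets that span
    [I, I]. *)
Lemma ideal_lbrv I : is_ideal I -> is_ideal (lbrv I I).
Proof.
move=> idI; apply/lbrv_subP => x y _.
have: (lbrv I I <= linfun (ad x) @^-1: lbrv I I)%VS.
  apply/lbrv_subP => u v uI vI; rewrite -memv_preim lfunE /= /ad lbr_derivation.
  by rewrite memvD // mem_lbrv // mem_ideal.
by move=> /subvP/(_ y); rewrite -memv_preim lfunE.
Qed.

(** A nonzero n^2 would fill the line n^1, and the series would be stationary at a nonzero term. *)
Lemma lower_central2_eq0 n : is_ideal n -> is_nilpotent n ->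
  \dim (lower_central n 1) = 1%N -> lower_central n 2 = 0%VS.
Proof.
move=> idn [l nl0] dim1; apply/eqP; apply: contraT => n2_neq0.
have n1n : (lower_central n 1 <= n)%VS.
  by apply/lbrv_subP => u v _; apply: mem_ideal.
have n2E : lower_central n 2 = lower_central n 1.
  apply/eqP; rewrite eqEdim dim1 lt0n dimv_eq0 n2_neq0 andbT.
  rewrite -[lower_central n 2]/(lbrv n (lower_central n 1)).
  apply/lbrv_subP => u v un /(subvP n1n) vn.
  by rewrite -[lower_central n 1]/(lbrv n n) mem_lbrv.
have n1E k : lower_central n k.+1 = lower_central n 1.
  by elim: k => // k IH; rewrite -[LHS]/(lbrv n (lower_central n k.+1)) IH.
have n1_neq0 : lower_central n 1 != 0%VS by rewrite -dimv_eq0 dim1.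
case: l nl0 => [|l]; last by rewrite n1E => /eqP; rewrite (negPf n1_neq0).
by move=> n0; move: n1n n1_neq0;
  rewrite -[n in (_ <= n)%VS]/(lower_central n 0) n0 subv0 => ->.
Qed.

(** The projection fixes the complement that models the quotient, so the induced endomorphism is
    again scalar. *)
Lemma quot_trace_scale (f : g -> g) U W (a : K) :
  {in U, forall v, f v = a *: v} -> quot_trace f U W = a *+ \dim (U :\: W).
Proof.
move=> fE; rewrite /quot_trace.
have qE u : @quot_end _ _ f U W u = a *: u.
  have uUW := subvsP u.
  rewrite /quot_end fE ?(subvP (diffvSl U W)) // !linearZ /=.
  by rewrite /addv_pi1 daddv_pi_id ?capv_diff // vsvalK.
under eq_bigr => i _.
  rewrite qE linearZ /= coord_free ?(basis_free (vbasisP _)) // eqxx mulr1.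
  over.
by rewrite big_const_ord iter_addr_0 dimvf.
Qed.

(** The line n^1 is an ideal, so [ad x] acts on it by a scalar. As n^2 = 0, this scalar is the trace
    on n^1/n^2, which vanishes. *)
Lemma central_lower_central1 n : is_ideal n -> is_nilpotent n ->
  strongly_unimodular n -> \dim (lower_central n 1) = 1%N ->
  forall x z, z \in lower_central n 1 -> lbr x z = 0.
Proof.
move=> idn niln tr0 dim1 x z zn1.
have [-> | z_neq0] := eqVneq z 0; first by rewrite linear0r.
have n1E : lower_central n 1 = <[z]>%VS.
  by apply/eqP; rewrite eq_sym eqEdim dim1 dim_vline z_neq0 -memvE zn1.
have := mem_ideal x (ideal_lbrv idn) zn1.
rewrite -[lbrv n n]/(lower_central n 1) n1E => /vlineP[a xz].
have := tr0 x 1%N; rewrite (lower_central2_eq0 idn niln dim1).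
rewrite (@quot_trace_scale _ _ _ a); last first.
  by move=> v; rewrite n1E => /vlineP[b ->]; rewrite /ad linearZr /= xz scalerA mulrC -scalerA.
have := dimv_cap_compl (lower_central n 1) 0; rewrite capv0 dimv0 add0n dim1 => ->.
by rewrite mulr1n xz => ->; rewrite scale0r.
Qed.

End Ideals.

(** * The torsion condition for a generalized Kähler pair *)

Section GeneralizedKahler.
Variables (R : realType) (g : lieAlgType R) (m : {dot g for idfun}).
Implicit Types (J : 'End(g)).

Lemma dotC x y : m x y = m y x.
Proof. by rewrite hermC /= expr0 mul1r. Qed.

Lemma hermitian_skew J : is_hermitian J m -> forall a b, m (J a) b = - m a (J b).
Proof. by move=> [[JJ _] mJ] a b; rewrite -mJ JJ linearNl. Qed.

Lemma gk_dfund Jp Jm : is_generalized_kahler Jp Jm m -> forall a b c,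
  dfund Jm m (Jm a) (Jm b) (Jm c) = - dfund Jp m (Jp a) (Jp b) (Jp c).
Proof.
move=> [hp hm _ _ H] a b c; have := H [tuple a; b; c].
rewrite !dc_fund_form // -!rmorphN -rmorphD /= => -[/eqP].
by rewrite addr_eq0 opprK => /eqP <-.
Qed.

(* As z is central, F is twice m (D_z _, _) up to sign, where D is the metric
   connection with D Jm = 0 and skew-symmetric torsion; the conclusion is
   D_z Jm = 0. *)
Lemma gk_central_form Jp Jm z : is_generalized_kahler Jp Jm m ->
  (forall x, lbr x z = 0) ->
  let F a b := m (lbr a b) z + dfund Jp m (Jp z) (Jp a) (Jp b) in
  forall a b, F (Jm a) b + F a (Jm b) = 0.
Proof.
move=> gk zc F a b; have [_ hm _ _ _] := gk; have [[JJ NJ] mJ] := hm.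
have T u v w : dfund Jp m (Jp u) (Jp v) (Jp w) = - dfund Jm m (Jm u) (Jm v) (Jm w).
  by rewrite (gk_dfund gk) opprK.
have zc' x : lbr z x = 0 by rewrite lbrC zc oppr0.
have dN u v : dfund Jm m (Jm z) (- u) v = - dfund Jm m (Jm z) u v.
  by rewrite /dfund; do !rewrite !(linearNl, linearNr, linearN) /=; ring.
have dN' u v : dfund Jm m (Jm z) u (- v) = - dfund Jm m (Jm z) u v.
  by rewrite /dfund; do !rewrite !(linearNl, linearNr, linearN) /=; ring.
have := dfund_type z a b hm.
have /(congr1 (fun v => m v (Jm z))) := NJ a b.
rewrite !linearBl /= !mJ linear0l /F !T !JJ dN dN' !opprK.
(* The unfolded occurrences have [z] itself as first argument: centrality leaves one bracket paired
   with [Jm z] in each, and integrability relates these to the brackets paired with [z]. *)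
rewrite {1 4}/dfund !zc !zc' !linear0l /=.
by move=> *; lra.
Qed.

End GeneralizedKahler.

(** * Orthogonal complements for a Euclidean inner product *)

Section Dot.
Variables (R : realType) (g : vectType R) (m : {dot g for idfun}).

Lemma exists_unit_vector (V : {vspace g}) : V != 0%VS ->
  exists2 v, v \in V & m v v = 1.
Proof.
move=> V_neq0; have v_neq0 : vpick V != 0 by rewrite vpick0.
have v_gt0 := @neq0_dnorm_gt0 _ _ _ m _ v_neq0.
exists ((Num.sqrt (m (vpick V) (vpick V)))^-1 *: vpick V).
  by rewrite memvZ // memv_pick.
rewrite linearZl linearZr /= mulrA -invfM -expr2 sqr_sqrtr ?(ltW v_gt0) //.
by rewrite mulVf // gt_eqF.
Qed.

(** Rank-nullity for the map sending [v] to its products with a basis of [V], whose kernel lies in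
    the orthogonal of [V]. *)
Lemma dim_orthov_ge (V : {vspace g}) :
  (\dim {:g} <= \dim (orthov m V) + \dim V)%N.
Proof.
pose f (v : g) : 'rV[R]_(\dim V) := \row_i m v (vbasis V)`_i.
have f_lin : linear f.
  by move=> a u v; apply/rowP => i; rewrite !mxE linearDl linearZl.
pose lf := GRing.isSemilinear.Build _ _ _ _ f (GRing.semilinear_linear f_lin).
pose F : {linear g -> 'rV[R]_(\dim V)} := HB.pack f lf.
rewrite -(limg_ker_dim (linfun F) {:g}) leq_add //.
  apply/dimvS/subvP => v; rewrite memv_cap memvf memv_ker (lfunE F) => /eqP fv0.
  apply/mem_orthovP => u /coord_vbasis ->; rewrite linear_sumr big1 //= => i _.
  by have /rowP/(_ i) := fv0; rewrite linearZr !mxE /= => ->; rewrite mulr0.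
by rewrite (leq_trans (dimvS (subvf _))) // dimvf dim_matrix mul1r.
Qed.

Lemma orthov_proper (V : {vspace g}) : (\dim V < \dim {:g})%N -> orthov m V != 0%VS.
Proof.
move=> ltV; rewrite -dimv_eq0 -lt0n -(ltn_add2r (\dim V)) add0n.
exact: leq_trans ltV (dim_orthov_ge V).
Qed.

Lemma mem_orthov_line v x : (v \in orthov m <[x]>%VS) = (m v x == 0).
Proof. exact: mem_orthov1. Qed.

Lemma mem_hyperplane (V : {vspace g}) x : \dim {:g} = (\dim V).+1 ->
  x \in orthov m V -> m x x = 1 -> forall v, (v \in V) = (m v x == 0).
Proof.
move=> dimV xV xx v; rewrite -mem_orthov_line.
have Vx : (V <= orthov m <[x]>)%VS by rewrite orthov_sym.
suff -> : V = orthov m <[x]> by [].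
apply/eqP; rewrite eqEdim Vx -ltnS -dimV ltnNge; apply/negP => full.
have /eqP xE : orthov m <[x]> == fullv by rewrite eqEdim subvf.
by have := memvf x; rewrite -xE mem_orthov_line xx oner_eq0.
Qed.

End Dot.

(** * Brackets in the frame [X], [W = J X], [Z], [U = J Z] *)

Section AdaptedFrame.
Variables (R : realType) (g : lieAlgType R) (m : {dot g for idfun}).
Variables (n : {vspace g}) (J : 'End(g)) (X Z : g).
Hypotheses (hJ : is_hermitian J m) (idn : is_ideal n).
Hypotheses (n1E : lower_central n 1 = <[Z]>%VS) (nE : forall v, (v \in n) = (m v X == 0)).
Hypotheses (XX : m X X = 1) (ZZ : m Z Z = 1) (Zcentral : forall v, lbr v Z = 0).
Hypotheses (JZn : J Z \in n) (idk3 : is_ideal (k3 n J m)).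

Local Notation W := (J X).
Local Notation U := (J Z).

Let JJ v : J (J v) = - v. Proof. by case: hJ => -[]. Qed.
Let mJ u v : m (J u) (J v) = m u v. Proof. by case: hJ. Qed.
Let skew := hermitian_skew hJ.

Let dotJ v : m (J v) v = 0.
Proof. by have := skew v v; rewrite (dotC m v) => ?; lra. Qed.

Let ZX : m Z X = 0.
Proof.
apply/eqP; rewrite -nE; have : Z \in lower_central n 1 by rewrite n1E memv_line.
by apply/subvP/lbrv_subP => u v _; apply: mem_ideal.
Qed.

Let UX : m U X = 0. Proof. by apply/eqP; rewrite -nE. Qed.
Let WZ : m W Z = 0. Proof. by rewrite skew dotC UX oppr0. Qed.
Let WW : m W W = 1. Proof. by rewrite mJ. Qed.
Let UU : m U U = 1. Proof. by rewrite mJ. Qed.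
Let WU : m W U = 0. Proof. by rewrite mJ dotC ZX. Qed.
Let UW : m U W = 0. Proof. by rewrite dotC WU. Qed.
Let UZ : m U Z = 0. Proof. exact: dotJ. Qed.
Let ZU : m Z U = 0. Proof. by rewrite dotC UZ. Qed.
Let WX : m W X = 0. Proof. exact: dotJ. Qed.
Let XW : m X W = 0. Proof. by rewrite dotC WX. Qed.
Let XU : m X U = 0. Proof. by rewrite dotC UX. Qed.
Let ZW : m Z W = 0. Proof. by rewrite dotC WZ. Qed.
Let XZ : m X Z = 0. Proof. by rewrite dotC ZX. Qed.
Let dots := (ZX, UX, WZ, WW, UU, WU, UW, UZ, ZU, WX, XW, XU, ZW, XZ, XX, ZZ).

Let Wn : W \in n. Proof. by rewrite nE WX. Qed.

(** The space [k2] is the orthogonal of [X] and [Z]; by skewness of [J], requiring [J v] in [k2]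
    adds orthogonality to [W] and [U]. *)
Lemma mem_k3 v :
  (v \in k3 n J m) = [&& m v X == 0, m v W == 0, m v Z == 0 & m v U == 0].
Proof.
have k2E u : (u \in k2 n m) = (m u Z == 0) && (m u X == 0).
  by rewrite /k2 memv_cap n1E mem_orthov_line nE.
have -> : (v \in k3 n J m) = (v \in k2 n m) && (J v \in k2 n m).
  rewrite /k3 memv_cap; congr (_ && _); apply/idP/idP.
    by move=> /memv_imgP[u uk ->]; move: uk; rewrite -memvN -(JJ u).
  move=> Jv; have -> : v = J (- J v) by rewrite linearN /= JJ opprK.
  by rewrite memv_img // memvN.
rewrite !k2E !skew !oppr_eq0; do 4!case: eqP => //.
Qed.

Let k3dots v : v \in k3 n J m -> [/\ m v X = 0, m v W = 0, m v Z = 0 & m v U = 0].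
Proof. by rewrite mem_k3 => /and4P[/eqP ? /eqP ? /eqP ? /eqP ?]. Qed.

Lemma nilradical_decomp v : v \in n ->
  exists2 k, k \in k3 n J m & v = m v W *: W + m v Z *: Z + m v U *: U + k.
Proof.
rewrite nE => /eqP vX; exists (v - (m v W *: W + m v Z *: Z + m v U *: U)); last first.
  by rewrite addrC subrK.
rewrite mem_k3 !linearBl !linearDl !linearZl /= !dots vX.
by apply/and4P; split; apply/eqP; ring.
Qed.

(** The bracket lies both on the line of [Z] and in the ideal [k3], which is orthogonal to [Z]. *)
Lemma k3_central v k : v \in n -> k \in k3 n J m -> lbr v k = 0.
Proof.
move=> vn kk; have [kX _ _ _] := k3dots kk.
have kn : k \in n by rewrite nE kX.
have [_ _ vkZ _] := k3dots (mem_ideal v idk3 kk).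
have /vlineP[a vkE] : lbr v k \in <[Z]>%VS.
  by rewrite -n1E -[lower_central n 1]/(lbrv n n) mem_lbrv.
by move: vkZ; rewrite vkE linearZl /= ZZ mulr1 => ->; rewrite scale0r.
Qed.

(* Since c contains [lbr W U], it is generalized before any rewriting of
   brackets with U. *)
Local Notation c := (m (lbr W U) Z).

Lemma lbr_WU : lbr W U = c *: Z.
Proof.
have /vlineP[a E] : lbr W U \in <[Z]>%VS.
  by rewrite -n1E -[lower_central n 1]/(lbrv n n) mem_lbrv.
by rewrite [in RHS]E linearZl /= ZZ mulr1.
Qed.

Lemma lbr_nilradical a b : a \in n -> b \in n ->
  lbr a b = (c * (m a W * m b U - m a U * m b W)) *: Z.
Proof.
move=> an bn; have Zc v : lbr Z v = 0 by rewrite lbrC Zcentral oppr0.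
set c' := c.
have k3c k v : v \in n -> k \in k3 n J m -> lbr k v = 0.
  by move=> vn kk; rewrite lbrC k3_central ?oppr0.
have WUE : lbr W U = c' *: Z by exact: lbr_WU.
have UWE : lbr U W = - (c' *: Z) by rewrite lbrC WUE.
have [k kk aE] := nilradical_decomp an; have [l lk bE] := nilradical_decomp bn.
rewrite {1}aE !linearDl !linearZl /= Zc scaler0 addr0 (k3c k) // addr0.
rewrite {1 2}bE !linearDr !linearZr /= !Zcentral (k3_central Wn lk) (k3_central JZn lk) !lbrxx.
rewrite WUE UWE !scaler0 !addr0 !add0r !scalerA -scaleNr scalerA -scalerDl.
by congr (_ *: _); ring.
Qed.

Lemma structure_const_neq0 : c != 0.
Proof.
apply/eqP => c0; have : (lbrv n n <= 0)%VS.
  by apply/lbrv_subP => u v un vn; rewrite lbr_nilradical // c0 mul0r scale0r mem0v.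
rewrite -[lbrv n n]/(lower_central n 1) n1E -memvE memv0 => /eqP Z0.
by move: ZZ; rewrite Z0 linear0l => /eqP; rewrite eq_sym oner_eq0.
Qed.

(** Integrability on [X], [Z] reduces to J [X, U] = [W, U], because [Z] is central. *)
Lemma lbr_XU : lbr X U = - c *: U.
Proof.
case: hJ => -[_ /(_ X Z)]; rewrite !Zcentral linear0 subr0 subr0 => N _.
have : J (lbr X U) = c *: Z.
  move/eqP: N; rewrite subr_eq0 => /eqP <-.
  exact: lbr_WU.
by move/(congr1 J); rewrite JJ linearZ /= => /eqP; rewrite eqr_oppLR -scaleNr => /eqP.
Qed.

(** Applying the derivation [ad X] to [W, U] = c Z gives 0 = (c g([X, W], W) - c^2) Z. *)
Lemma lbr_XW_W : m (lbr X W) W = c.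
Proof.
have XWn : lbr X W \in n by apply: mem_ideal.
move: lbr_WU lbr_XU (lbr_nilradical XWn JZn) structure_const_neq0.
move: (c) => c' WUE XUE XWU c_neq0.
have := lbr_derivation X W U; rewrite XUE WUE XWU !linearZr /= Zcentral WUE !dots scaler0.
rewrite !scalerA -scalerDl => /eqP; rewrite eq_sym scaler_eq0 => /orP[/eqP E|/eqP Z0].
  apply: (mulfI c_neq0); move: (m (lbr X W) W) (m (lbr X W) U) E => p q E.
  by move: E; rewrite mulr1 mulr0 subr0 mulNr => /eqP; rewrite subr_eq0 => /eqP.
by move: ZZ; rewrite Z0 linear0l => /eqP; rewrite eq_sym oner_eq0.
Qed.

Lemma mem_nilradical_part a : a - m a X *: X \in n.
Proof. by rewrite nE linearBl linearZl /= XX mulr1 subrr. Qed.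

Lemma lbrU a : lbr a U = - c * m a X *: U + c * m a W *: Z.
Proof.
have := lbr_nilradical (mem_nilradical_part a) JZn.
rewrite !linearBl !linearZl /= lbr_XU !dots => /eqP; rewrite subr_eq => /eqP ->.
by rewrite addrC scalerA; congr (_ *: _ + _ *: _); ring.
Qed.

(** This is the form of [gk_central_form] at the central vector [Z]. The [gam] terms are
    [J]-invariant and cancel, as do those coupling [X] and [Z]; the area form of the plane <W, U>
    remains twice. *)
Lemma central_formE a b :
  m (lbr a b) Z + dfund J m U (J a) (J b) = 2 * c * (m a W * m b U - m a U * m b W).
Proof.
pose gam := m (lbr X W) Z.
have XB b' : b' \in n -> m (lbr X b') Z = gam * m b' W.
  move=> b'n; have [k kk {1}->] := nilradical_decomp b'n.
  have [_ _ XkZ _] := k3dots (mem_ideal X idk3 kk).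
  rewrite !linearDr !linearZr /= !linearDl !linearZl /= Zcentral lbr_XU XkZ.
  by rewrite linear0l linearZl /= !dots /gam; ring.
have BE a' b' : m (lbr a' b') Z = gam * (m a' X * m b' W - m a' W * m b' X)
    + c * (m a' W * m b' U - m a' U * m b' W).
  have sumB p q s t : p \in n -> q \in n -> m (lbr (p + s *: X) (q + t *: X)) Z =
      s * (gam * m q W) - t * (gam * m p W) + c * (m p W * m q U - m p U * m q W).
    move=> pn qn; rewrite !linearDl !linearDr /= !linearZl !linearZr /= lbrxx.
    rewrite (lbrC p X) (lbr_nilradical pn qn) !linearDl !linearZl !linearNl /=.
    by rewrite linear0l !XB // ZZ; ring.
  have := sumB _ _ (m a' X) (m b' X) (mem_nilradical_part a') (mem_nilradical_part b').
  by rewrite !subrK !linearBl !linearZl /= !dots => ->; ring.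
have Jdot u : [/\ m (J u) X = - m u W, m (J u) W = m u X, m (J u) Z = - m u U
   & m (J u) U = m u Z] by rewrite !mJ !skew.
move: BE lbrU; move: (c) => c' BE aU.
rewrite /dfund !JJ !linearNr /= BE (lbrC U) !aU !linearNl /= (BE (J a)).
have [aX aW aZ aV] := Jdot a; have [bX bW bZ bV] := Jdot b.
rewrite ?(aX, aW, aV, bX, bW, bV) !linearDl !linearZl /=.
by rewrite (dotC m U a) (dotC m U b) (dotC m Z a) (dotC m Z b); ring.
Qed.

Lemma not_generalized_kahler J' : ~ is_generalized_kahler J J' m.
Proof.
move=> gk; have [_ hJ' _ _ _] := gk; have [[JJ' NJ'] mJ'] := hJ'.
have skew' := hermitian_skew hJ'.
have dotJ' v : m (J' v) v = 0 by have := skew' v v; rewrite (dotC m v) => ?; lra.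
pose th a b := m a W * m b U - m a U * m b W.
have thJ a b : th (J' a) b + th a (J' b) = 0.
  have := gk_central_form gk Zcentral a b; rewrite /= !central_formE.
  move: structure_const_neq0; move: (c) => c' c_neq0.
  rewrite -mulrDr => /eqP; rewrite !mulf_eq0 pnatr_eq0 (negPf c_neq0) /=.
  by move/eqP.
(* The kernel of [th] is the orthogonal of <W, U>; pairing with [W] and [U] in [thJ] shows that [J']
   preserves it. *)
have preserve b : m b W = 0 -> m b U = 0 -> m (J' b) W = 0 /\ m (J' b) U = 0.
  move=> bW bU; move: (thJ W b) (thJ U b); rewrite /th !dots bW bU.
  by split; lra.
have [JXW JXU] := preserve X XW XU.
have JXn : J' X \in n by rewrite nE dotJ'.
have JWn : J' W \in n by rewrite nE skew' dotC JXW oppr0.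
have Jk k : m k W = 0 -> m k U = 0 -> m (J' W) k = 0.
  by move=> kW kU; have [E _] := preserve k kW kU; rewrite skew' dotC E oppr0.
have [k kk JWE] := nilradical_decomp JWn.
have [kX kW kZ kU] := k3dots kk.
(* Pairing [J' W] with [k] gives the squared norm of [k], but also 0 by [Jk]. *)
have k0 : k = 0.
  apply/eqP; apply: contraT => k_neq0.
  have := @neq0_dnorm_gt0 _ _ _ m _ k_neq0.
  have := Jk k kW kU; rewrite {1}JWE !linearDl !linearZl /=.
  rewrite (dotC m W) (dotC m Z) (dotC m U) kW kZ kU => kk0.
  have -> : m k k = 0 by lra.
  by rewrite ltxx.
have JWU : J' W = m (J' W) U *: U.
  by rewrite {1}JWE k0 dotJ' (Jk Z ZW ZU) !scale0r !add0r addr0.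
(* Both brackets with [J' X] vanish, as it lies in [n] without [W]- or [U]-component; what remains
   is [X, W] = - J' [X, J' W]. *)
move: (NJ' X W).
rewrite (lbr_nilradical JXn JWn) (lbr_nilradical JXn Wn) JXW JXU !mul0r subrr mulr0 scale0r.
rewrite linear0 oppr0 !add0r => /eqP; rewrite addr_eq0 opprK => /eqP VE.
have XJW : J' (lbr X (J' W)) = (m (J' W) U * - c) *: J' U.
  by rewrite {1}JWU linearZr /= lbr_XU !linearZ /= scalerA.
have := lbr_XW_W; rewrite -VE XJW.
move: structure_const_neq0; move: (c) => c' c_neq0.
have UJW : m (J' U) W = - m (J' W) U by rewrite skew' (dotC m U).
rewrite linearNl linearZl /= UJW; move: (m (J' W) U) => e E.
have /eqP : c' * (1 + e ^+ 2) = 0 by rewrite mulrDr mulr1 -[X in X + _]E; ring.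
by rewrite mulf_eq0 (negPf c_neq0) gt_eqF // ltr_pwDl // sqr_ge0.
Qed.

End AdaptedFrame.

Theorem proposition8p3 (R : realType) (g : lieAlgType R) (n : {vspace g})
    (g_nonkahler : ~ exists (J : 'End(g)) (m : {dot g for idfun}), is_kahler J m)
    (dim_g : \dim {: g} = 6%N)
    (g_almost_nilpotent : almost_nilpotent n)
    (g_strongly_unimodular : strongly_unimodular n)
    (dim_n1 : \dim (lower_central n 1) = 1%N) :
  ~ exists (Jp Jm : 'End(g)) (m : {dot g for idfun}),
      [/\ is_generalized_kahler Jp Jm m,
          (Jp @: lower_central n 1 <= n)%VS,
          is_ideal (k3 n Jp m) & is_abelian (k3 n Jp m)].
Proof.
move=> [Jp [Jm [m [gk Jn1 idk3 _]]]].
have [_ [idn niln _] dim_n] := g_almost_nilpotent.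
have [|Z Zn1 ZZ] := @exists_unit_vector _ _ m (lower_central n 1).
  by rewrite -dimv_eq0 dim_n1.
have n1E : lower_central n 1 = <[Z]>%VS.
  apply/eqP; rewrite eq_sym eqEdim dim_n1 dim_vline -memvE Zn1 lt0b.
  by apply: contra_eqN ZZ => /eqP ->; rewrite linear0l eq_sym oner_eq0.
(* Codimension one provides a unit normal to [n], which turns membership in [n] into a scalar
   equation. *)
have [|X Xn XX] := @exists_unit_vector _ _ m (orthov m n).
  by apply: orthov_proper; rewrite dim_n.
have nE := mem_hyperplane dim_n Xn XX.
have Zcentral v := central_lower_central1 idn niln g_strongly_unimodular dim_n1 v Zn1.
have JZn : Jp Z \in n by rewrite (subvP Jn1) ?memv_img.
have hJ : is_hermitian Jp m by case: gk.
exact: (not_generalized_kahler hJ idn n1E nE XX ZZ Zcentral JZn idk3 gk).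
Qed.
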